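(* Let $b=3$. There exists no Pythagorean Type 2 triangle with base $3$ repeated digits. In other words, there exists no triangle which is a $T_2(k,3,d)$, for any integers $k\geq 2$ and $d$ with $2\leq d\leq b-1=2$.
   Context: A Pythagorean triangle is a right triangle all of whose side lengths are positive integers. For integers $b\geq 3$, $2\leq d\leq b-1$ and $k\geq 2$, $d_{k,b}=d\,(b^{k-1}+\cdots+b+1)=\dfrac{d(b^k-1)}{b-1}$ denotes the positive integer whose base $b$ representation consists of $k$ digits all equal to $d$. A Pythagorean triangle is a Type 2 triangle with base $b$ repeated digits, denoted $T_2(k,b,d)$ (with $b\geq 3$, $2\leq d\leq b-1$, $k\geq 2$), if one of its legs has length $d^k$ and the other leg has length $d_{k,b}$. *)

(* Defs.v *)
From mathcomp Require Import all_boot.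
Set Implicit Arguments.
Unset Strict Implicit.
Unset Printing Implicit Defensive.

(* d_{k,b} = d (b^(k-1) + ... + b + 1) *)
Definition repdigit (k b d : nat) : nat := d * \sum_(i < k) b ^ i.

(* Legs x and y, hypotenuse z. *)
Definition pythagorean_triangle (x y z : nat) : Prop :=
  [/\ 0 < x, 0 < y, 0 < z & x ^ 2 + y ^ 2 = z ^ 2].

(* The triangle with legs x, y and hypotenuse z is a T_2(k, b, d); the two legs
   are unordered. *)
Definition type2_triangle (k b d x y z : nat) : Prop :=
  [/\ 3 <= b, 2 <= d <= b - 1, 2 <= k, pythagorean_triangle x y z
    & (x = d ^ k /\ y = repdigit k b d) \/ (y = d ^ k /\ x = repdigit k b d)].

(* Main.v *)
Require Import Defs.
From mathcomp Require Import all_boot.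

(** The obstruction is a congruence modulo 3.  The square of an integer prime
    to 3 is 1 modulo 3, so a sum of two such squares is 2 modulo 3, which is
    not a quadratic residue: every Pythagorean triangle has a leg divisible
    by 3 ([pythagorean_leg_dvd3]).  In base 3 the only digit to consider is
    [d = 2].  The leg [2 ^ k] is prime to 3, and so is the repdigit leg, whose
    residue modulo the base is its last digit 2 ([repdigit_mod]). *)

Lemma repdigit_mod (k b d : nat) : 0 < k -> repdigit k b d = d %[mod b].
Proof.
case: k => // k _; rewrite /repdigit big_ord_recl expn0 mulnDr muln1.
under eq_bigr => i _ do rewrite expnS.
by rewrite -big_distrr /= mulnCA addnC mulnC modnMDl.
Qed.

Lemma sqr_mod3 (n : nat) : n ^ 2 %% 3 = ~~ (3 %| n).
Proof.
rewrite -modnXm /dvdn; have : n %% 3 < 3 by rewrite ltn_mod.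
by case: (n %% 3) => [|[|[|]]].
Qed.

Lemma pythagorean_leg_dvd3 (x y z : nat) :
  x ^ 2 + y ^ 2 = z ^ 2 -> (3 %| x) || (3 %| y).
Proof.
move/(congr1 (modn^~ 3)); rewrite -modnDm !sqr_mod3.
by case: (3 %| x); case: (3 %| y); case: (3 %| z).
Qed.

Theorem theorem3 (k d : nat) (hk : 2 <= k) (hd : 2 <= d <= 3 - 1) :
  ~ exists x y z : nat, type2_triangle k 3 d x y z.
Proof.
have d2 : d = 2 by apply/eqP; rewrite eqn_leq andbC.
have pow_ndvd : ~~ (3 %| d ^ k) by rewrite d2 Euclid_dvdX.
have rep_ndvd : ~~ (3 %| repdigit k 3 d).
  by rewrite /dvdn repdigit_mod ?d2 // ltnW.
move=> [x [y [z [_ _ _ [_ _ _ /pythagorean_leg_dvd3 leg] legs]]]].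
by move: leg; case: legs => -[-> ->]; rewrite (negPf pow_ndvd) (negPf rep_ndvd).
Qed.
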